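(* Let $M$ be a proper set system over a finite ground set $V$. Then $M$ is a matroid described by its bases if and only if both (1) $M$ is equicardinal, and (2) for each $X\subseteq V$, $\min(M*X)$ is equicardinal.
   Context: A set system is a pair $M=(V,D)$ with $V$ a finite set (the ground set) and $D$ a family of subsets of $V$; it is proper if $D\neq\varnothing$. $\triangle$ denotes symmetric difference. For $X\subseteq V$, the pivot (twist) of $M$ on $X$ is $M*X=(V,\{Y\triangle X \mid Y\in D\})$. $\min(M)$ is the set system on $V$ whose sets are the members of $D$ that are minimal with respect to inclusion. A set system is equicardinal if all its sets have the same cardinality. ''$M=(V,D)$ is a matroid described by its bases'' means that $D$ is the family of bases of a matroid on $V$. *)

(* Defs.v *)
From mathcomp Require Import all_boot.
Set Implicit Arguments.
Unset Strict Implicit.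
Unset Printing Implicit Defensive.

(* The ground set is the whole finite type V; a set system (V, D) on it is
   given by its family D. *)
Definition set_system (V : finType) := {set {set V}}.

Definition proper_system (V : finType) (M : set_system V) : Prop := M != set0.

Definition symdiff (V : finType) (A B : {set V}) : {set V} :=
  (A :\: B) :|: (B :\: A).

Definition pivot (V : finType) (M : set_system V) (X : {set V}) : set_system V :=
  [set symdiff Y X | Y in M].

Definition min_system (V : finType) (M : set_system V) : set_system V :=
  [set Y | minset [in M] Y].

Definition equicardinal (V : finType) (M : set_system V) : Prop :=
  forall A B : {set V}, A \in M -> B \in M -> #|A| = #|B|.

Record matroid (V : finType) := Matroid {
  indep : {set {set V}};
  indep_set0 : set0 \in indep;
  indep_subset : forall A B : {set V},
    B \in indep -> A \subset B -> A \in indep;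
  indep_augment : forall A B : {set V},
    A \in indep -> B \in indep -> #|A| < #|B| ->
    exists2 x, x \in B :\: A & x |: A \in indep
}.

Definition bases (V : finType) (N : matroid V) : set_system V :=
  [set B | maxset [in indep N] B].

Definition is_matroid_by_bases (V : finType) (M : set_system V) : Prop :=
  exists N : matroid V, M = bases N.

(* Main.v *)
(* For sets Y of a fixed cardinality, |Y △ X| is decreasing in |Y ∩ X|. Hence,
   once M is equicardinal, min(M * X) is equicardinal when the maximal traces
   Y ∩ X (Y in M) all have the same size. For the bases of a matroid this
   follows by augmenting a smaller trace inside X and completing the result to
   a basis. Conversely, if A and B are contained in members of M and A cannot be
   augmented from B, then A is a maximal trace on X = A ∪ B, so |B| <= |A|. *)
Require Import Defs.
From mathcomp Require Import all_boot.
From mathcomp Require Import zify.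

Set Implicit Arguments.
Unset Strict Implicit.
Unset Printing Implicit Defensive.

Section SymmetricDifference.
Variable V : finType.
Implicit Types X Y Z : {set V}.

Lemma card_symdiff Y X : #|symdiff Y X| + #|Y :&: X|.*2 = #|Y| + #|X|.
Proof.
rewrite /symdiff cardsU.
have -> : (Y :\: X) :&: (X :\: Y) = set0.
  by apply/setP => x; rewrite !inE; case: (x \in X); case: (x \in Y).
rewrite cards0 subn0 -(cardsID X Y) -(cardsID Y X) (setIC X Y); lia.
Qed.

(** Twisting by [X] complements sets inside [X] and leaves them alone outside, so inclusion is
    reversed on [X] and kept off [X]. *)
Lemma sub_symdiff Y Z X :
  (symdiff Y X \subset symdiff Z X) =
  (Z :&: X \subset Y) && (Y \subset Z :|: X).
Proof.
apply/idP/andP => [/subsetP YZ | [/subsetP ZY /subsetP YZ]].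
  split; apply/subsetP => x; move: (YZ x); rewrite !inE;
    by case: (x \in X); case: (x \in Y); case: (x \in Z) => //= ->.
apply/subsetP => x; move: (ZY x) (YZ x); rewrite !inE.
by case: (x \in X); case: (x \in Y); case: (x \in Z) => //= h1 h2;
  first [exact: h1 | exact: h2].
Qed.

Lemma min_pivotP (M : set_system V) X (A : {set V}) :
  reflect (exists Y, [/\ Y \in M, A = symdiff Y X &
             forall Z, Z \in M -> Z \subset Y :|: X -> Y :&: X \subset Z ->
               symdiff Z X = symdiff Y X])
          (A \in min_system (pivot M X)).
Proof.
rewrite inE; apply: (iffP minsetP) => [[/imsetP[Y MY ->] minY] | [Y [MY -> minY]]].
  exists Y; split=> // Z MZ ZYX YXZ; apply: minY; first exact: imset_f.
  by rewrite sub_symdiff YXZ.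
split=> [|_ /imsetP[Z MZ ->]]; first exact: imset_f.
by rewrite sub_symdiff => /andP[YXZ ZYX]; exact: minY.
Qed.

End SymmetricDifference.

Section MatroidBases.
Variables (V : finType) (N : matroid V).
Implicit Types B I X Y : {set V}.

Lemma basis_indep B : B \in bases N -> B \in indep N.
Proof. by rewrite inE => /maxsetp. Qed.

Lemma leq_card_basis B I : B \in bases N -> I \in indep N -> #|I| <= #|B|.
Proof.
move=> baB indI; rewrite leqNgt; apply/negP => ltBI.
have [x] := indep_augment (basis_indep baB) indI ltBI.
rewrite inE => /andP[xB _] indxB; move: baB; rewrite inE => /maxsetP[_ maxB].
by move: xB; rewrite -(maxB _ indxB (subsetUr _ _)) setU11.
Qed.

Lemma bases_equicardinal : equicardinal (bases N).
Proof.
move=> A B baA baB; apply/eqP; rewrite eqn_leq.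
by rewrite !leq_card_basis ?basis_indep.
Qed.

(** A maximal independent set between [I] and [I :|: B] works: were it smaller than [B], augmenting
    it from [B] would stay in that range. The upper bound matters when a trace is completed without
    leaving [Y :|: X]. *)
Lemma extend_to_basis I B : I \in indep N -> B \in bases N ->
  exists C, [/\ C \in bases N, I \subset C & C \subset I :|: B].
Proof.
move=> indI baB.
pose P J := (J \in indep N) && (J \subset I :|: B).
have [|C maxC IC] := @maxset_exists _ P I; first by rewrite /P indI subsetUl.
have /andP[indC CIB] := maxsetp maxC.
have leBC : #|B| <= #|C|.
  rewrite leqNgt; apply/negP => ltCB.
  have [x] := indep_augment indC (basis_indep baB) ltCB.
  rewrite inE => /andP[xC xB] indxC.
  have PxC : P (x |: C) by rewrite /P indxC subUset CIB sub1set inE xB orbT.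
  have [_ maxC'] := maxsetP maxC.
  by move: xC; rewrite -(maxC' _ PxC (subsetUr _ _)) setU11.
exists C; split=> //; rewrite inE; apply/maxsetP; split=> // J indJ CJ.
apply/eqP; rewrite eq_sym eqEcard CJ.
exact: leq_trans (leq_card_basis baB indJ) leBC.
Qed.

Lemma min_pivot_bases_equicardinal X :
  equicardinal (min_system (pivot (bases N) X)).
Proof.
(* Only the minimality of the twist of [Y] is needed to bound the other trace; applying this both
   ways equates the traces, and [card_symdiff] then equates the sizes. *)
suff le_trace Y Z : Y \in bases N -> Z \in bases N ->
    (forall C, C \in bases N -> C \subset Y :|: X -> Y :&: X \subset C ->
       symdiff C X = symdiff Y X) -> #|Z :&: X| <= #|Y :&: X|.
  move=> _ _ /min_pivotP[Y [baY -> minY]] /min_pivotP[Z [baZ -> minZ]].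
  have := le_trace _ _ baY baZ minY; have := le_trace _ _ baZ baY minZ.
  have := bases_equicardinal baY baZ.
  have := card_symdiff Y X; have := card_symdiff Z X; lia.
move=> baY baZ minY; rewrite leqNgt; apply/negP => lt_trace.
have indI B : B \in bases N -> B :&: X \in indep N.
  by move/basis_indep/indep_subset; apply; rewrite subsetIl.
have [x] := indep_augment (indI _ baY) (indI _ baZ) lt_trace.
rewrite !inE => /andP[xYX /andP[xZ xX]] indx.
(* Completing from [Y] itself keeps [C] between [Y :&: X] and [Y :|: X], so minimality forces [C]
   and [Y] to agree; but [x] lies in [C] and not in [Y]. *)
have [C [baC xC CY]] := extend_to_basis indx baY.
have xYXC : Y :&: X \subset C by apply: subset_trans xC; exact: subsetUr.
have CYX : C \subset Y :|: X.
  apply: subset_trans CY _; rewrite !subUset sub1set !inE xX orbT subsetUl.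
  by rewrite (subset_trans (subsetIl _ _)) ?subsetUl.
have /setP/(_ x) := minY _ baC CYX xYXC.
by rewrite !inE (subsetP xC) ?setU11 //; move: xYX; rewrite xX /= andbT => ->.
Qed.

End MatroidBases.

Section MatroidOfEquicardinalMinima.
Variables (V : finType) (M : set_system V).
Hypothesis M_proper : proper_system M.
Hypothesis M_equicard : equicardinal M.
Hypothesis min_equicard :
  forall X : {set V}, equicardinal (min_system (pivot M X)).

(** The only possible independent sets if [M] is to be the family of bases. *)
Definition subsets_of_members : {set {set V}} :=
  [set A : {set V} | [exists Y in M, A \subset Y]].

Lemma subsets_of_membersP (A : {set V}) :
  reflect (exists2 Y, Y \in M & A \subset Y) (A \in subsets_of_members).
Proof. by rewrite inE; exact: exists_inP. Qed.

Lemma subsets_of_members0 : set0 \in subsets_of_members.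
Proof.
have /set0Pn[Y MY] := M_proper.
by apply/subsets_of_membersP; exists Y; rewrite ?sub0set.
Qed.

Lemma subsets_of_members_sub (A B : {set V}) :
  B \in subsets_of_members -> A \subset B -> A \in subsets_of_members.
Proof.
move=> /subsets_of_membersP[Y MY BY] AB.
by apply/subsets_of_membersP; exists Y; rewrite ?(subset_trans AB).
Qed.

Lemma subsets_of_members_augment (A B : {set V}) :
  A \in subsets_of_members -> B \in subsets_of_members -> #|A| < #|B| ->
  exists2 x, x \in B :\: A & x |: A \in subsets_of_members.
Proof.
move=> /subsets_of_membersP[Y MY AY] /subsets_of_membersP[Z MZ BZ] ltAB.
apply/exists_inP; apply: contraT => /exists_inPn noaug.
set X := A :|: B.
(* An element of [C :&: X] outside [A] would lie in [B] and augment [A] within [C]. *)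
have traceA C : C \in M -> A \subset C -> C :&: X = A.
  move=> MC sAC; apply/eqP; rewrite eqEsubset subsetI sAC subsetUl !andbT.
  apply/subsetP => x; rewrite !inE => /andP[xC xX]; apply: contraT => nxA.
  have := noaug x; rewrite inE nxA (negPf nxA) /= in xX *.
  move=> /(_ xX)/subsets_of_membersP[].
  by exists C => //; rewrite subUset sub1set xC.
(* Any competitor [C] contains [Y :&: X], which is [A], so it also has trace [A]; the twists then
   have equal size, and inclusion becomes equality. *)
have minY : symdiff Y X \in min_system (pivot M X).
  apply/min_pivotP; exists Y; split=> // C MC CYX; rewrite traceA // => sAC.
  apply/eqP; rewrite eqEcard sub_symdiff CYX traceA // sAC /=.
  have := card_symdiff Y X; have := card_symdiff C X.
  rewrite !traceA // (M_equicard MC MY); lia.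
(* The twist of [Z] may fail to be minimal, but a minimal [W] below it has the size of the twist of
   [Y]. Hence the trace of [Z], which contains [B], is no larger than [A]. *)
have [|W minW WZ] := @minset_exists _ [in pivot M X] (symdiff Z X).
  exact: imset_f.
have minW' : W \in min_system (pivot M X) by rewrite inE.
have := subset_leq_card WZ; rewrite -(min_equicard minY minW').
have BZX : B \subset Z :&: X by rewrite subsetI BZ subsetUr.
have := subset_leq_card BZX.
have := card_symdiff Y X; have := card_symdiff Z X.
rewrite (traceA Y) // (M_equicard MY MZ); lia.
Qed.

Lemma is_matroid_of_equicardinal_minima : is_matroid_by_bases M.
Proof.
exists (Matroid subsets_of_members0 subsets_of_members_sub
                subsets_of_members_augment).
apply/setP => B; rewrite inE; apply/idP/maxsetP => /= [MB | [indB maxB]].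
  split=> [|C /subsets_of_membersP[Y MY CY] BC].
    by apply/subsets_of_membersP; exists B.
  (* [C] lies between the members [B] and [Y], which have equal size. *)
  apply/eqP; rewrite eq_sym eqEcard BC (M_equicard MB MY).
  exact: subset_leq_card.
have /subsets_of_membersP[Y MY BY] := indB.
by rewrite -(maxB Y) //; apply/subsets_of_membersP; exists Y.
Qed.

End MatroidOfEquicardinalMinima.

Theorem corollary4p3 (V : finType) (M : set_system V) (M_proper : proper_system M) :
  is_matroid_by_bases M <->
  (equicardinal M /\
   forall X : {set V}, equicardinal (min_system (pivot M X))).
Proof.
split=> [[N ->] | [M_eq min_eq]].
  by split; [exact: bases_equicardinal | exact: min_pivot_bases_equicardinal].
exact: is_matroid_of_equicardinal_minima.
Qed.
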